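(* Let $x_0\in\mathrm{dom}\,\psi$, $v_0=x_0$, and let the sequences $\{v_t\}_{t\ge0}$ and $\{x_t\}_{t\ge0}$ be generated by the Projecting Reduced-Gradient Method: for each $t\ge0$, a) $x_{t+1}\in\mathrm{dom}\,\psi$ together with $V_\psi(x_{t+1})=V(x_{t+1})+\psi'_{x_{t+1}}$, $\psi'_{x_{t+1}}\in\partial\psi(x_{t+1})$, satisfies $$\langle V_\psi(x_{t+1}),v_t-x_{t+1}\rangle>0\ge\langle V_\psi(x_{t+1}),x^*-x_{t+1}\rangle\quad\forall x^*\in X^*;$$ b) $v_{t+1}=\arg\min_{x\in Q_t}\beta(v_t,x)$, where $Q_t=\{x\in\mathrm{dom}\,\psi:\langle V_\psi(x_{t+1}),x_{t+1}-x\rangle\ge0\}$. Let $b_i=\frac{\langle V_\psi(x_i),v_{i-1}-x_i\rangle^2}{2\|V_\psi(x_i)\|_*^2}$ for $i\ge1$ and $B_t=\sum_{i=1}^tb_i$ ($B_0=0$). Then for any $t\ge0$ and $x^*\in X^*$, $$\beta(v_t,x^* )+B_t\le\beta(x_0,x^* ).$$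
   Context: $\mathbb{E}$ is a finite-dimensional real vector space with dual $\mathbb{E}^*$, equipped with an arbitrary norm $\|\cdot\|$; $\|g\|_*=\max\{\langle g,x\rangle:\|x\|\le1\}$. $\psi$ is a proper closed convex function on $\mathbb{E}$ and $V:\mathrm{dom}\,\psi\to\mathbb{E}^*$ is a monotone operator: $\langle V(x)-V(y),x-y\rangle\ge0$ for $x,y\in\mathrm{dom}\,\psi$. $X^*$ is the set of points $x^*\in\mathrm{dom}\,\psi$ with $\langle V(x),x-x^*\rangle+\psi(x)\ge\psi(x^* )$ for all $x\in\mathrm{dom}\,\psi$. $d$ is a differentiable convex prox-function (with $\mathrm{dom}\,\psi\subseteq\mathrm{dom}\,d\subseteq\mathbb{E}$) which is strongly convex with parameter one: $d(y)\ge d(x)+\langle\nabla d(x),y-x\rangle+\frac12\|y-x\|^2$ for $x,y\in\mathrm{dom}\,d$. The Bregman distance is $\beta(x,y)=d(y)-d(x)-\langle\nabla d(x),y-x\rangle$. The minimizers defining $v_{t+1}$ are assumed to exist. *)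

(* Defs.v *)
From HB Require Import structures.
From mathcomp Require Import all_boot all_order all_algebra.
From mathcomp Require Import all_classical all_reals all_analysis.

Set Implicit Arguments.
Unset Strict Implicit.
Unset Printing Implicit Defensive.

Import Order.TTheory GRing.Theory Num.Theory.
Import numFieldNormedType.Exports.

Local Open Scope classical_set_scope.
Local Open Scope ring_scope.

(* Finite-dimensional normed spaces: the norm (and its topology) comes from the
   normed module structure, the finite dimension from the vector structure. *)
#[short(type="normedVectType")]
HB.structure Definition NormedVector (R : numDomainType) :=
  {E of NormedModule R E & Vector R E}.

Section Definitions.
Context {R : realType} {E : normedVectType R}.
Implicit Types (f : E -> \bar R) (D : set E).

(* The maximum over the (compact) unit ball, rendered as a supremum. *)
Definition dual_norm (g : 'Hom(E, R^o)) : R :=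
  sup [set (g x : R) | x in [set x : E | `|x| <= 1]].

Definition dom f : set E := [set x | (f x < +oo)%E].

Definition epigraph f : set (E * R) := [set p | (f p.1 <= p.2%:E)%E].

Definition proper_fun f : Prop :=
  dom f !=set0 /\ forall x, (-oo < f x)%E.

Definition closed_fun f : Prop := closed (epigraph f).

Definition convex_fun f : Prop :=
  convex_set (dom f) /\ convex_function (dom f) (fine \o f).

Definition subdifferential f (x : E) : set 'Hom(E, R^o) :=
  [set g | forall y, (f x + (g (y - x))%:E <= f y)%E].

Definition monotone_on D (V : E -> 'Hom(E, R^o)) : Prop :=
  forall x y, D x -> D y -> 0 <= (V x - V y) (x - y).

(* Solutions in the weak (Minty) sense: [V] is evaluated at the test point [x]. *)
Definition vi_solutions (psi : E -> \bar R) (V : E -> 'Hom(E, R^o)) : set E :=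
  [set xs | dom psi xs /\
     forall x, dom psi x -> (psi xs <= (V x (x - xs))%:E + psi x)%E].

(* [gd] is a gradient of [d] on [dom d]. The first-order expansion is taken
   along [dom d], so that boundary points of [dom d] are allowed; at interior
   points this is Frechet differentiability. *)
Definition gradient_on_dom (d : E -> \bar R) (gd : E -> 'Hom(E, R^o)) : Prop :=
  forall x, dom d x ->
    forall e : R, 0 < e -> \forall y \near within (dom d) (nbhs x),
      `|fine (d y) - fine (d x) - gd x (y - x)| <= e * `|y - x|.

Definition strongly_convex1 (d : E -> \bar R) (gd : E -> 'Hom(E, R^o)) : Prop :=
  forall x y, dom d x -> dom d y ->
    fine (d x) + gd x (y - x) + 2^-1 * `|y - x| ^+ 2 <= fine (d y).

Definition bregman (d : E -> \bar R) (gd : E -> 'Hom(E, R^o)) (x y : E) : R :=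
  fine (d y) - fine (d x) - gd x (y - x).

Definition is_argmin (Q : set E) (h : E -> R) (v : E) : Prop :=
  Q v /\ forall x, Q x -> h v <= h x.

(* The localization set of a subgradient [g] taken at the point [z]. *)
Definition cut_set (psi : E -> \bar R) (g : 'Hom(E, R^o)) (z : E) : set E :=
  [set x | dom psi x /\ 0 <= g (z - x)].

(* [g i] is the reduced gradient V_psi(x_i). *)
Definition prg_step (g : nat -> 'Hom(E, R^o)) (v x : nat -> E) (i : nat) : R :=
  (g i (v i.-1 - x i)) ^+ 2 / (2 * dual_norm (g i) ^+ 2).

Definition prg_sum (g : nat -> 'Hom(E, R^o)) (v x : nat -> E) (t : nat) : R :=
  \sum_(1 <= i < t.+1) prg_step g v x i.

(* [s i] is the chosen subgradient psi'_{x_i}; only the [s i] with [0 < i]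
   matter. *)
Definition prg_method (psi : E -> \bar R) (V : E -> 'Hom(E, R^o))
    (d : E -> \bar R) (gd : E -> 'Hom(E, R^o))
    (x v : nat -> E) (s : nat -> 'Hom(E, R^o)) : Prop :=
  [/\ dom psi (x 0%N), v 0%N = x 0%N &
   forall t : nat, let g := V (x t.+1) + s t.+1 in
   [/\ dom psi (x t.+1),
       subdifferential psi (x t.+1) (s t.+1),
       0 < g (v t - x t.+1),
       (forall xs, vi_solutions psi V xs -> g (xs - x t.+1) <= 0) &
       is_argmin (cut_set psi g (x t.+1)) (bregman d gd (v t)) (v t.+1)]].

End Definitions.

(* Main.v *)
(** Strong convexity gives [beta (v t) (v t.+1) >= `|v t - v t.+1| ^+ 2 / 2], and
    since [v t.+1] lies in the half-space cut by [g t.+1] while [v t] does not,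
    this is at least [b_(t+1)]. Every solution stays in the cut set, so the
    first-order optimality condition at [v t.+1] makes the Bregman distance to
    it drop by at least [beta (v t) (v t.+1)] at each step. *)
Require Import Defs.
From HB Require Import structures.
From mathcomp Require Import all_boot all_order all_algebra.
From mathcomp Require Import all_classical all_reals all_analysis.
From mathcomp Require Import ring lra.

Import Order.TTheory GRing.Theory Num.Theory.
Import numFieldNormedType.Exports.

Local Open Scope classical_set_scope.
Local Open Scope ring_scope.

Section Bregman.
Context {R : realType} {E : normedVectType R}.
Implicit Types (g : 'Hom(E, R^o)) (psi d : E -> \bar R).
Implicit Types (gd : E -> 'Hom(E, R^o)) (D Q : set E).

(* An unbounded [g] would have the junk supremum [0]; excluding that value
   spares the proof that linear forms on [E] are bounded. *)
Lemma le_dual_norm g (x : E) :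
  dual_norm g != 0 -> g x <= dual_norm g * `|x|.
Proof.
move=> gN0; have [->|xN0] := eqVneq x 0; first by rewrite linear0 normr0 mulr0.
have supg : has_sup [set (g y : R) | y in [set y : E | `|y| <= 1]].
  by apply: contrapT => /sup_out g0; move: gN0; rewrite /dual_norm g0 eqxx.
have x0 : 0 < `|x| by rewrite normr_gt0.
rewrite -ler_pdivrMr// mulrC.
have -> : `|x|^-1 * g x = g (`|x|^-1 *: x) by rewrite linearZ.
apply: ub_le_sup; first exact: supg.2.
by exists (`|x|^-1 *: x) => //=; rewrite normrZ normfV normr_id mulVf ?gt_eqF.
Qed.

Lemma convex_set_segment D (x y : E) (k : R) : convex_set D ->
  D x -> D y -> 0 <= k <= 1 -> D (x + k *: (y - x)).
Proof.
move=> cD Dx Dy /andP[k0 k1].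
(* [conv] puts the weight [k] on its first argument, hence [y] before [x]. *)
have := cD y x (Itv01 k0 k1); rewrite !inE => /(_ Dy Dx).
rewrite /conv/= scalerBl scale1r scalerBr.
by rewrite [X in D X]addrCA.
Qed.

Lemma convex_cut_set psi g (z : E) :
  convex_set (dom psi) -> convex_set (cut_set psi g z).
Proof.
move=> cpsi x y k; rewrite !inE => -[px gx] [py gy]; split.
  by have := cpsi x y k; rewrite !inE; exact.
have -> : z - conv k x y = k%:num *: (z - x) + (1 - k%:num) *: (z - y).
  rewrite [conv k x y]/(k%:num *: x + (1 - k%:num) *: y) 2!scalerBr.
  by rewrite addrACA -scalerDl [_ + (1 - _)]addrC subrK scale1r opprD.
rewrite linearD !linearZ/=; apply: addr_ge0; apply: mulr_ge0 => //.
Qed.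

(* First-order optimality, from the expansion of [d] at [w] along the segment
   from [w] to [y]. *)
Lemma argmin_bregman_ge0 d gd Q (v w y : E) :
  convex_set Q -> Q `<=` dom d -> gradient_on_dom d gd ->
  is_argmin Q (bregman d gd v) w -> Q y ->
  0 <= (gd w - gd v) (y - w).
Proof.
move=> cQ Qd dgd [Qw wmin] Qy; apply/ler_addgt0Pr => e e0.
set n := `|y - w|; have n0 : 0 < n + 1 by rewrite ltr_wpDl ?normr_ge0.
(* With this tolerance, a displacement [k *: (y - w)] costs at most [k * e]. Using [n + 1] rather
   than [n] covers [y = w]. *)
have e'0 : 0 < e / (n + 1) by exact: divr_gt0.
have := dgd w (Qd _ Qw) _ e'0.
rewrite near_withinE => /nbhs_ballP[r /= r0 wr].
(* The bound [1] keeps the point on the segment, the other one keeps it in the ball of radius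
   [r]. *)
pose k := Num.min 1 (r / (n + 1) / 2).
have k0 : 0 < k by rewrite lt_min ltr01 !divr_gt0//.
have kr : k * n < r.
  apply: (@le_lt_trans _ _ (r / (n + 1) / 2 * n)).
    by rewrite ler_wpM2r ?normr_ge0// /k ge_min lexx orbT.
  have -> : r / (n + 1) / 2 * n = r * (n / (n + 1)) / 2 by field; lra.
  have : n / (n + 1) <= 1 by rewrite ler_pdivrMr// mul1r lerDl.
  nra.
have Qk : Q (w + k *: (y - w)).
  by apply: convex_set_segment => //; rewrite (ltW k0) /k ge_min lexx.
have kE : w + k *: (y - w) - w = k *: (y - w) by rewrite addrC addKr.
have := wr (w + k *: (y - w)); rewrite -ball_normE /= opprD addNKr normrN.
rewrite normrZ (gtr0_norm k0) => /(_ kr (Qd _ Qk)).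
have -> : gd w (w + k *: (y - w) - w) = k * gd w (y - w) :> R.
  by rewrite kE (linearZ_LR (gd w)).
rewrite kE normrZ (gtr0_norm k0) -/n => dw.
have {dw} := le_trans (ler_norm _) dw.
have := wmin _ Qk; rewrite /bregman.
have -> : gd v (w + k *: (y - w) - v) = gd v (w - v) + k * gd v (y - w) :> R.
  by rewrite addrAC linearD (linearZ_LR (gd v)).
rewrite lfunE/= opp_lfunE.
move: (fine (d (w + _))) => dk vmin dw.
have en : e / (n + 1) * n <= e.
  by rewrite mulrAC ler_pdivrMr// ler_pM2l// lerDl.
have H3 : e / (n + 1) * (k * n) <= k * e.
  by rewrite mulrCA ler_pM2l.
have : 0 <= k * (gd w (y - w) - gd v (y - w) + e) :> R.
  by rewrite mulrDr mulrBr; lra.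
by rewrite pmulr_rge0.
Qed.

(** Three-point identity: the right side minus the left side is exactly [(gd w - gd v) (y - w)],
    nonnegative by optimality of [w]. *)
Lemma bregman_argmin_le d gd Q (v w y : E) :
  convex_set Q -> Q `<=` dom d -> gradient_on_dom d gd ->
  is_argmin Q (bregman d gd v) w -> Q y ->
  bregman d gd w y + bregman d gd v w <= bregman d gd v y.
Proof.
move=> cQ Qd dgd vw Qy.
have := argmin_bregman_ge0 _ _ _ _ _ _ cQ Qd dgd vw Qy.
rewrite /bregman lfunE/= opp_lfunE.
have -> : y - v = (y - w) + (w - v) by rewrite addrA subrK.
rewrite linearD; lra.
Qed.

Lemma bregman_ge_cut d gd g (v w z : E) : strongly_convex1 d gd ->
  dom d v -> dom d w -> 0 < g (v - z) -> 0 <= g (z - w) ->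
  g (v - z) ^+ 2 / (2 * dual_norm g ^+ 2) <= bregman d gd v w.
Proof.
move=> dsc dv dw gvz gzw.
have vw : 2^-1 * `|w - v| ^+ 2 <= bregman d gd v w.
  by rewrite /bregman; have := dsc v w dv dw; lra.
apply: le_trans vw.
(* If the dual norm is [0], the quotient is [0] by the convention on division. *)
have [->|gN0] := eqVneq (dual_norm g) 0.
  by rewrite expr0n/= mulr0 invr0 mulr0 mulr_ge0// ?invr_ge0 ?sqr_ge0.
have gvw : g (v - z) <= dual_norm g * `|w - v|.
  rewrite distrC; apply: le_trans (le_dual_norm _ _ gN0).
  (* Passing through [z] only adds the nonnegative term [g (z - w)]. *)
  have -> : v - w = (v - z) + (z - w) by rewrite addrA subrK.
  by rewrite [leRHS]linearD lerDl.
rewrite invfM mulrCA ler_pM2l ?invr_gt0// ler_pdivrMr ?exprn_even_gt0//.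
rewrite mulrC -exprMn ler_pXn2r// nnegrE ?ltW//.
exact: lt_le_trans gvw.
Qed.

End Bregman.

Theorem theorem3 (R : realType) (E : normedVectType R)
    (psi : E -> \bar R) (V : E -> 'Hom(E, R^o))
    (d : E -> \bar R) (gd : E -> 'Hom(E, R^o))
    (x v : nat -> E) (s : nat -> 'Hom(E, R^o))
    (psi_proper : proper_fun psi) (psi_closed : closed_fun psi)
    (psi_convex : convex_fun psi)
    (V_monotone : monotone_on (dom psi) V)
    (d_proper : proper_fun d) (d_convex : convex_fun d)
    (dom_sub : dom psi `<=` dom d)
    (d_grad : gradient_on_dom d gd)
    (d_strong : strongly_convex1 d gd)
    (xv_prg : prg_method psi V d gd x v s)
    (t : nat) (xs : E) (xs_sol : vi_solutions psi V xs) :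
  bregman d gd (v t) xs + prg_sum (fun i => V (x i) + s i) v x t
    <= bregman d gd (x 0%N) xs.
Proof.
have [x0 v0 step] := xv_prg.
(* Strong convexity is available only between points of [dom d]. *)
have psiv n : dom psi (v n).
  by case: n => [|n]; [rewrite v0|have [_ _ _ _ [[]]] := step n].
elim: t => [|t IH]; first by rewrite v0 /prg_sum big_geq// addr0.
have [_ _ gv gxs vmin] := step t.
(* Cancelling the first [t] terms leaves the one-step decrease by the last term. *)
apply: le_trans IH; rewrite /prg_sum big_nat_recr//= addrA addrAC lerD2r.
set g := V (x t.+1) + s t.+1 in gv gxs vmin *.
have Qd : cut_set psi g (x t.+1) `<=` dom d by move=> y [/dom_sub].
have Qxs : cut_set psi g (x t.+1) xs.
  by split; [exact: xs_sol.1|rewrite -opprB linearN/= oppr_ge0; exact: gxs].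
have cQ : convex_set (cut_set psi g (x t.+1)).
  by apply: convex_cut_set; exact: psi_convex.1.
apply: le_trans (bregman_argmin_le _ _ _ _ _ _ cQ Qd d_grad vmin Qxs).
rewrite lerD2l; apply: bregman_ge_cut => //; [exact/dom_sub..|].
by have [[]] := vmin.
Qed.
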